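(* Let $(X,\omega,J)$ be a Kähler manifold of complex dimension $m$ and let $L_1,\dots,L_n$ be Lagrangians in $X$ intersecting transversely. Let $u:\mathbb{D}\to X$ be a disc connecting intersection points $\vec x,y$ of $\{L_k\}_k$. Let $E=u^*T^{1,0}X$, with boundary Lagrangian subbundles $F_k=u^*T^{1,0}L_k|_{u(\partial\mathbb{D})\cap L_k}$ over the boundary arcs $I_k$, $k=1,\dots,n$, and let $E^D$ be the associated doubled holomorphic bundle over $S^2$. Then the partial Maslov indices of $u$ are all no less than $1$ (i.e. all positive) if and only if $E^D$ is Griffiths positive.
   Context: A Kähler manifold $(X,\omega,J)$ is a closed manifold with a complex structure $J$ and a symplectic form $\omega$ such that $\omega(\cdot,J\cdot)>0$ and $\omega(J\cdot,J\cdot)=\omega(\cdot,\cdot)$. A Lagrangian is an embedded submanifold of half the dimension on which $\omega$ vanishes. $\mathbb{D}\subset\mathbb{C}$ is the (closed) unit disc. Discs. Let $x_k\in L_k\cap L_{k+1}$ ($k=1,\dots,n-1$), $y\in L_1\cap L_n$, $\vec x=(x_1,\dots,x_{n-1})$. For $k=1,\dots,n$ let $I_k\subset\partial\mathbb{D}$ be the circle segment between $e^{2\pi i(k-1)/n}$ and $e^{2\pi i k/n}$ (ordered counterclockwise starting at $1$). A disc connecting $\vec x$ and $y$ is a smooth map $u:(\mathbb{D},\partial\mathbb{D})\to(X,\cup_kL_k)$ with $u(e^{2\pi i k/n})=x_k$ for $k=1,\dots,n-1$, $u(1)=y$, and $u(I_k)\subset L_k$ for $k=1,\dots,n$. Bundles.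 $E=u^*T^{1,0}X$ is a holomorphic vector bundle over $\mathbb{D}$, with holomorphic structure the $(0,1)$-part of the pullback of the Levi-Civita connection, and $T^{1,0}L_k:=\{s-iJs: s\in TL_k\}$. Partial Maslov indices of a loop. The Lagrangian Grassmannian of $\mathbb{C}^m$ is $\Lambda(m)\cong\mathrm{U}(m)/\mathrm{O}(m)$. For a loop $\tau:\partial\mathbb{D}\to\mathrm{U}(m)/\mathrm{O}(m)$ of class $\mathcal{C}^\alpha$, $0<\alpha<1$, there are a map $\Theta:\mathbb{D}\to\mathrm{GL}(m,\mathbb{C})$, of class $\mathcal{C}^\alpha$ on $\partial\mathbb{D}$ and holomorphic on $\mathbb{D}$, and unique integers $\kappa_1\ge\dots\ge\kappa_m$ such that $\tau(\zeta)=\Theta(\zeta)\Lambda^{1/2}(\zeta)\mathbb{R}^m$ for $\zeta\in\partial\mathbb{D}$, where $\Lambda(\zeta)=\mathrm{diag}(\zeta^{\kappa_1},\dots,\zeta^{\kappa_m})$ (the sign ambiguity of the square roots does not affect the subspace). The $\kappa_j$ are the partial Maslov indices of $\tau$. Partial Maslov indices of a disc. Viewing $E$ as a holomorphic bundle over $\mathbb{D}$ with fiber $\mathbb{C}^m$, each $F_k$ gives a path $u|_{I_k}:I_k\to\Lambda(m)$. At each of the points $x_k$ and $y$ the two Lagrangians meeting there (with $L_{n+1}=L_1$) are modelled, in Darboux coordinates, by $\mathbb{R}^m$ and $i\mathbb{R}^m$, which are joined by the canonical short path $t\mapsto e^{-\pi i t/2}\mathbb{R}^m$, $t\in[0,1]$.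 Let $v_k$ be the path obtained by multiplying the path $u|_{I_k}$, traversed counterclockwise with parameter $t\in[0,|I_k|]$, by the scalar matrix $\Phi_k(t)=e^{-\frac{\pi i}{2|I_k|}t}\,\mathrm{Id}_m$. The concatenation $v_1\circ\dots\circ v_n$ is a piecewise smooth loop in $\Lambda(m)$; the partial Maslov indices of $u$ are the partial Maslov indices $\kappa_1\ge\dots\ge\kappa_m$ of this loop. Doubled holomorphic bundle. Put $F_k'=\Phi_kF_k$; these patch together to a piecewise smooth Lagrangian subbundle $F$ of $E|_{\partial\mathbb{D}}$ (corresponding to the loop $v_1\circ\dots\circ v_n$). Let $\overline E$ be the conjugate bundle over the conjugate disc $\overline{\mathbb{D}}$. Gluing $E$ and $\overline E$ along the boundary so that $F$ and $\overline F$ coincide yields a bundle $E^D$ over $S^2=\mathbb{D}\cup\overline{\mathbb{D}}=\mathbb{C}\mathrm{P}^1$. Let $\Theta:\mathbb{D}\to\mathrm{GL}(m,\mathbb{C})$, of class $\mathcal{C}^\alpha$ on $\partial\mathbb{D}$ and holomorphic on $\mathbb{D}$, and $\Lambda(\zeta)=\mathrm{diag}(\zeta^{\kappa_1},\dots,\zeta^{\kappa_m})$, with $\kappa_1\ge\dots\ge\kappa_m$ the partial Maslov indices of $u$, be such that $(v_1\circ\dots\circ v_n)(\zeta)=\Theta(\zeta)\Lambda^{1/2}(\zeta)\mathbb{R}^m$ for $\zeta\in\partial\mathbb{D}$. Then $E^D$ is made holomorphic by the trivializations $\Theta^{-1}$ over $\mathbb{D}$, $\overline\Theta$ over $\overline{\mathbb{D}}$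 and $\Lambda$ over a thickened neighbourhood of $\partial\mathbb{D}$, that is, it is the holomorphic bundle determined by the clutching function $\Lambda(\zeta)=\mathrm{diag}(\zeta^{\kappa_1},\dots,\zeta^{\kappa_m})$, with the convention that the clutching function $\zeta^\kappa$ gives the degree $\kappa$ holomorphic line bundle $\mathcal{O}(\kappa)$. $E^D$ is called the doubled holomorphic bundle. Griffiths positivity. Let $V$ be a holomorphic vector bundle over a Kähler manifold $M$ with hermitian structure $h$, and let $\mathcal{K}$ be the curvature, an $\mathrm{End}(V)$-valued $(1,1)$-form, of its Chern connection (the unique connection compatible with $h$ and the holomorphic structure). $V$ is Griffiths positive if at every $x\in M$, $\langle\mathcal{K}\xi,\xi\rangle_h(s,\bar s)>0$ for all nonzero $(1,0)$-tangent vectors $s$ at $x$ and all nonzero $\xi\in V_x$. A holomorphic bundle without a specified hermitian structure is Griffiths positive if it admits a hermitian structure with this property.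
   Formalization: The rotated paths v_1,…,v_n are assumed to close up to a loop, i.e. at each corner the next Lagrangian's tangent space is J times the previous one's; for merely transverse Lagrangians the concatenation need not be a loop, and the partial Maslov indices and E^D are then undefined. *)

(* Defs.v *)
From HB Require Import structures.
From mathcomp Require Import all_boot all_order all_algebra.
From mathcomp Require Import all_classical all_reals all_analysis.
From mathcomp Require Import complex.
Set Implicit Arguments.
Unset Strict Implicit.
Unset Printing Implicit Defensive.
Import Order.TTheory GRing.Theory Num.Theory.
Import numFieldNormedType.Exports.
Local Open Scope classical_set_scope.
Local Open Scope complex_scope.
Local Open Scope ring_scope.

Section Smoothness.
Context {R : realType}.

Fixpoint Ck (k : nat) (E F : normedModType R) (A : set E) (f : E -> F) : Prop :=
  (forall x, A x -> {for x, continuous f}) /\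
  match k with
  | 0 => True
  | k'.+1 => (forall x v, A x -> derivable f x v) /\
             (forall v, Ck k' A (fun x => 'D_v f x))
  end.

(* C^oo on an open subset A of a finite-dimensional space E *)
Definition smooth_on (E F : normedModType R) (A : set E) (f : E -> F) : Prop :=
  forall k, Ck k A f.

(* The complex plane C = R[i] and its real coordinates; real partial
   derivatives of a function of z = x + iy are taken in (x, y). *)
Definition cx (p : R * R) : R[i] := p.1 +i* p.2.
Definition pl (z : R[i]) : R * R := (complex.Re z, complex.Im z).
Definition iunit : R[i] := 0 +i* 1.
Definition cis (t : R) : R[i] := cos t +i* sin t.
Definition cabs (z : R[i]) : R := complex.Re `|z|.

Definition udisc : set R[i] := [set z | cabs z <= 1].
Definition udisc_int : set R[i] := [set z | cabs z < 1].

Definition real_deriv (F : normedModType R) (f : R[i] -> F) (v z : R[i]) : F :=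
  'D_(pl v) (f \o cx) (pl z).

(* Smoothness at a point of a set that need not be open, such as the closed
   disc: existence of a smooth local extension. *)
Definition smooth_at_within (F : normedModType R) (A : set R[i]) (z : R[i])
    (f : R[i] -> F) : Prop :=
  exists (U : set (R * R)) (g : R * R -> F),
    [/\ open U, U (pl z), smooth_on U g &
        forall p, U p -> A (cx p) -> g p = f (cx p)].

End Smoothness.

Section Manifolds.
Context {R : realType}.
Variable m : nat.

(* Model space of a complex m-manifold: (a, b) stands for a + ib in C^m. *)
Notation V := ('rV[R]_m * 'rV[R]_m)%type.

Definition J0 (v : V) : V := (- v.2, v.1).

(* For a tangent vector s = (a, b) = \sum_j (a_j d/dx_j + b_j d/dy_j), the
   coordinates of s - iJs in the basis (d/dx_j - i d/dy_j)_j of T^{1,0}. *)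
Definition T10 (s : V) : 'cV[R[i]]_m := \col_j (s.1 0 j +i* s.2 0 j).

(* Closed manifold with a complex structure, given by a holomorphic atlas: J
   is read in each chart as J0. *)
Record complex_manifold (X : topologicalType) := ComplexManifold {
  chart_idx : Type ;
  dom : chart_idx -> set X ;
  phi : chart_idx -> X -> V ;
  psi : chart_idx -> V -> X ;
  img := fun i => phi i @` dom i ;
  manifold_hausdorff : hausdorff_space X ;
  manifold_compact : compact [set: X] ;
  dom_cover : forall p, exists i, dom i p ;
  dom_open : forall i, open (dom i) ;
  img_open : forall i, open (img i) ;
  phiK : forall i p, dom i p -> psi i (phi i p) = p ;
  phi_continuous : forall i p, dom i p -> {for p, continuous (phi i)} ;
  psi_continuous : forall i x, img i x -> {for x, continuous (psi i)} ;
  transition_smooth : forall i j,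
    smooth_on (phi i @` (dom i `&` dom j)) (phi j \o psi i) ;
  transition_holomorphic : forall i j p a, dom i p -> dom j p ->
    'D_(J0 a) (phi j \o psi i) (phi i p) =
    J0 ('D_a (phi j \o psi i) (phi i p))
}.

Variables (X : topologicalType) (M : complex_manifold X).
Notation I := (chart_idx M).

(* Change of the coordinates of tangent vectors at p from chart i to chart j. *)
Definition dtrans (i j : I) (p : X) (a : V) : V :=
  'D_a (phi j \o psi i) (phi i p).

(* Kaehler form; omega i x is the 2-form at the point of coordinates x in the
   chart i. Nondegeneracy is a consequence of omega_pos. In omega_closed, the
   left-hand side is d(omega) on constant vector fields. *)
Record kahler_form := KahlerForm {
  omega : I -> V -> V -> V -> R ;
  omega_smooth : forall i a b, smooth_on (img i) (fun x => omega i x a b) ;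
  omega_linear : forall i x c a a' b, img i x ->
    omega i x (c *: a + a') b = c * omega i x a b + omega i x a' b ;
  omega_anti : forall i x a b, img i x -> omega i x a b = - omega i x b a ;
  omega_trans : forall i j p a b, dom i p -> dom j p ->
    omega i (phi i p) a b =
    omega j (phi j p) (dtrans i j p a) (dtrans i j p b) ;
  omega_closed : forall i x a b c, img i x ->
    'D_a (fun z => omega i z b c) x + 'D_b (fun z => omega i z c a) x
    + 'D_c (fun z => omega i z a b) x = 0 ;
  omega_J : forall i x a b, img i x -> omega i x (J0 a) (J0 b) = omega i x a b ;
  omega_pos : forall i x a, img i x -> a != 0 -> 0 < omega i x a (J0 a)
}.

Variable K : kahler_form.

Definition metric (i : I) (x a b : V) : R := omega K i x a (J0 b).

(* Local connection forms G: in the chart i, the connection is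
   nabla_v s = D_v s + G i x v s. Levi-Civita: torsion-free and metric. *)
Definition levi_civita (G : I -> V -> V -> V -> V) : Prop :=
  forall i x, img i x ->
    [/\ forall c v v' s, G i x (c *: v + v') s = c *: G i x v s + G i x v' s,
        forall v s, G i x v s = G i x s v &
        forall v a b, 'D_v (fun z => metric i z a b) x =
          metric i x (G i x v a) b + metric i x a (G i x v b)].

(* Embedded submanifold of half the dimension, by slice charts. *)
Definition embedded_half (L : set X) : Prop :=
  forall p, L p -> exists (i : I) (W : set V) (F F' : V -> V),
    dom i p /\ open W /\ W (phi i p) /\ W `<=` img i /\
    open (F @` W) /\ smooth_on W F /\ smooth_on (F @` W) F' /\
    (forall x, W x -> F' (F x) = x) /\
    (forall x, W x -> (L (psi i x) <-> (F x).2 = 0)).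

(* Tangent vectors at p, in the chart i, as velocities of curves in L. *)
Definition tangent (L : set X) (i : I) (p : X) : set V :=
  [set a | exists (e : R) (g : R -> V),
    [/\ 0 < e, g 0 = phi i p, 'D_1 g 0 = a,
        smooth_on [set t : R | `|t| < e] g &
        forall t : R, `|t| < e -> img i (g t) /\ L (psi i (g t))]].

Definition lagrangian (L : set X) : Prop :=
  embedded_half L /\
  forall i p a b, L p -> dom i p -> tangent L i p a -> tangent L i p b ->
    omega K i (phi i p) a b = 0.

Definition transverse (L L' : set X) : Prop :=
  forall i p, L p -> L' p -> dom i p ->
  forall w : V, exists a b, [/\ tangent L i p a, tangent L' i p b & w = a + b].

(* Discs. The families L and x are indexed by the naturals 1, 2, 3 and so on. *)
Definition smooth_disc (u : R[i] -> X) : Prop :=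
  forall z, udisc z -> exists i : I,
    [/\ dom i (u z),
        exists U : set (R * R), [/\ open U, U (pl z) &
          forall p, U p -> udisc (cx p) -> dom i (u (cx p))] &
        smooth_at_within udisc z (phi i \o u)].

Definition arc_len (n : nat) : R := 2 * pi / n%:R.

Definition disc_connecting (n : nat) (L : nat -> set X) (x : nat -> X) (y : X)
    (u : R[i] -> X) : Prop :=
  [/\ smooth_disc u,
      forall k, (1 <= k < n)%N -> u (cis (k%:R * arc_len n)) = x k,
      u 1 = y &
      forall k (t : R), (1 <= k <= n)%N ->
        k.-1%:R * arc_len n <= t <= k%:R * arc_len n -> L k (u (cis t))].

(* The bundle E = u^* T^{1,0}X. Under s |-> s - iJs, a section of E is a vector
   field s along u, given by its chart coordinates s i z for u z in dom i. *)
Definition field_along (u : R[i] -> X) (s : I -> R[i] -> V) : Prop :=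
  (forall i j z, udisc z -> dom i (u z) -> dom j (u z) ->
     s j z = dtrans i j (u z) (s i z)) /\
  (forall i z, udisc z -> dom i (u z) ->
     smooth_at_within (udisc `&` u @^-1` dom i) z (s i)).

(* Pulled back connection nabla_v s. *)
Definition cov (G : I -> V -> V -> V -> V) (u : R[i] -> X)
    (s : I -> R[i] -> V) (i : I) (v z : R[i]) : V :=
  real_deriv (s i) v z +
  G i (phi i (u z)) (real_deriv (phi i \o u) v z) (s i z).

(* nabla^{0,1} (s - iJs) = 0 unfolds to nabla_x s + J nabla_y s = 0, since J is
   parallel. *)
Definition holomorphic_section G (u : R[i] -> X) (s : I -> R[i] -> V) : Prop :=
  field_along u s /\
  forall i z, udisc_int z -> dom i (u z) ->
    cov G u s i 1 z + J0 (cov G u s i iunit z) = 0.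

Definition frame_mx (e : 'I_m -> I -> R[i] -> V) (i : I) (z : R[i]) :
    'M[R[i]]_m := \matrix_(j, a) T10 (e a i z) j 0.

(* A holomorphic frame of E, smooth up to the boundary, identifies every fiber
   of E with C^m. *)
Definition holomorphic_frame G (u : R[i] -> X) (e : 'I_m -> I -> R[i] -> V) :=
  (forall a, holomorphic_section G u (e a)) /\
  (forall i z, udisc z -> dom i (u z) -> frame_mx e i z \in unitmx).

(* The fiber at z of u^* T^{1,0}L, as a real subspace of C^m. *)
Definition boundary_fiber (u : R[i] -> X) (e : 'I_m -> I -> R[i] -> V)
    (L : set X) (z : R[i]) : set 'cV[R[i]]_m :=
  [set c | exists (i : I) (s : V),
    [/\ dom i (u z), tangent L i (u z) s & frame_mx e i z *m c = T10 s]].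

(* tau is the concatenation of the paths v_k, i.e. of the boundary paths
   multiplied by Phi_k(t) = exp (- pi i t / (2 |I_k|)). At the corners, both
   adjacent arcs prescribe the value of tau: the v_k do match there. *)
Definition maslov_loop (n : nat) (L : nat -> set X) (u : R[i] -> X)
    (e : 'I_m -> I -> R[i] -> V) (tau : R[i] -> set 'cV[R[i]]_m) : Prop :=
  forall k (t : R), (1 <= k <= n)%N -> 0 <= t <= arc_len n ->
    let z := cis (k.-1%:R * arc_len n + t) in
    tau z = [set cis (- (pi / (2 * arc_len n)) * t) *: c
            | c in boundary_fiber u e (L k) z].

End Manifolds.

Section PartialIndices.
Context {R : realType}.
Variable m : nat.

Definition Lambda (kappa : 'I_m -> int) (z : R[i]) : 'M[R[i]]_m :=
  diag_mx (\row_j z ^ kappa j).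

(* A square root of Lambda at cis t; another choice of t with the same cis t
   only changes signs of diagonal entries. *)
Definition Lambda_half (kappa : 'I_m -> int) (t : R) : 'M[R[i]]_m :=
  diag_mx (\row_j cis ((kappa j)%:~R * t / 2)).

Definition maslov_factorization (alpha : R) (tau : R[i] -> set 'cV[R[i]]_m)
    (Theta : R[i] -> 'M[R[i]]_m) (kappa : 'I_m -> int) : Prop :=
  [/\ forall z, udisc z -> Theta z \in unitmx,
      forall i j, {within (udisc : set R[i]^o),
        continuous (fun z : R[i]^o => Theta z i j : R[i]^o)},
      forall i j z, udisc_int z ->
        derivable (fun z : R[i]^o => Theta z i j : R[i]^o) z 1,
      forall i j, exists C : R, forall s t : R,
        cabs (Theta (cis s) i j - Theta (cis t) i j)
          <= C * cabs (cis s - cis t) `^ alpha &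
      forall t : R, tau (cis t) =
        [set Theta (cis t) *m Lambda_half kappa t
               *m map_mx (real_complex R) r | r in [set: 'cV[R]_m]]].

Definition partial_maslov_indices (alpha : R) (tau : R[i] -> set 'cV[R[i]]_m)
    (kappa : 'I_m -> int) : Prop :=
  (forall j k : 'I_m, (j <= k)%N -> kappa k <= kappa j) /\
  exists Theta, maslov_factorization alpha tau Theta kappa.

End PartialIndices.

(* kappa are the partial Maslov indices of the disc u, where nabla is the
   Levi-Civita connection. *)
Definition disc_partial_maslov_indices (R : realType) (m : nat)
    (X : topologicalType) (M : complex_manifold m X) nabla (n : nat)
    (L : nat -> set X) (u : R[i] -> X) (alpha : R) (kappa : 'I_m -> int) :=
  exists (e : 'I_m -> chart_idx M -> R[i] -> 'rV[R]_m * 'rV[R]_m)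
         (tau : R[i] -> set 'cV[R[i]]_m),
    [/\ holomorphic_frame nabla u e, maslov_loop n L u e tau &
        partial_maslov_indices alpha tau kappa].

Section CisLemmas.
Context {R : realType}.

Lemma cis0 : cis 0 = 1 :> R[i].
Proof. by rewrite /cis cos0 sin0. Qed.

Lemma cisD (s t : R) : cis (s + t) = cis s * cis t.
Proof.
by apply/eqP; rewrite /cis cosD sinD eq_complex /= eqxx addrC (mulrC (cos s)) eqxx.
Qed.

Lemma conjc_cis (t : R) : conjc (cis t) = cis (- t).
Proof. by rewrite /cis cosN sinN. Qed.

Lemma cisN (t : R) : cis (- t) = (cis t)^-1.
Proof.
have h : cis (- t) * cis t = 1 by rewrite -cisD addNr cis0.
have u : cis t != 0.
  by apply/eqP => c0; move: h; rewrite c0 mulr0 => /esym/eqP; rewrite oner_eq0.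
by rewrite -[LHS](mulfK u) h mul1r.
Qed.

Lemma cisX (k : int) (t : R) : cis t ^ k = cis (k%:~R * t).
Proof.
have H n : cis t ^+ n = cis (n%:R * t).
  elim: n => [|n IH]; first by rewrite expr0 mul0r cis0.
  by rewrite exprS IH -cisD -natr1 mulrDl mul1r addrC.
case: k => n; first by rewrite -exprnP H pmulrn.
by rewrite NegzE -exprnN H -cisN mulrNz mulNr pmulrn.
Qed.

End CisLemmas.

Section BundlesOnSphere.
Context {R : realType}.
Variable m : nat.
Notation Mfun := (R[i] -> 'M[R[i]]_m).

(* CP^1 is covered by two copies of C glued by w = 1 / z on C \ {0}. A clutching
   function g, holomorphic from C \ {0} to GL_m, defines the holomorphic bundle
   obtained from two trivial bundles by identifying b at w with a = g(z) b at z;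
   z ^ kappa gives the bundle O(kappa) of degree kappa. *)

Definition adjmx p q (A : 'M[R[i]]_(p, q)) : 'M[R[i]]_(q, p) :=
  (map_mx (@conjc R) A)^T.

Definition deriv_c (f : R[i] -> R[i]) (v z : R[i]) : R[i] :=
  real_deriv (fun z => complex.Re (f z)) v z +i* real_deriv (fun z => complex.Im (f z)) v z.
Definition dz (f : R[i] -> R[i]) (z : R[i]) : R[i] :=
  (deriv_c f 1 z - iunit * deriv_c f iunit z) / 2.
Definition dzbar (f : R[i] -> R[i]) (z : R[i]) : R[i] :=
  (deriv_c f 1 z + iunit * deriv_c f iunit z) / 2.
Definition dz_mx (A : Mfun) (z : R[i]) : 'M[R[i]]_m :=
  \matrix_(i, j) dz (fun w => A w i j) z.
Definition dzbar_mx (A : Mfun) (z : R[i]) : 'M[R[i]]_m :=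
  \matrix_(i, j) dzbar (fun w => A w i j) z.

(* Hermitian metric <xi, eta> = eta^* H xi on the trivial bundle over C. *)
Definition hermitian_metric (H : Mfun) : Prop :=
  (forall i j, smooth_on setT ((fun z => complex.Re (H z i j)) \o cx) /\
               smooth_on setT ((fun z => complex.Im (H z i j)) \o cx)) /\
  forall z, adjmx (H z) = H z /\
    forall xi : 'cV[R[i]]_m, xi != 0 -> 0 < (adjmx xi *m H z *m xi) 0 0.

(* The connection d + a dz + b dzbar is the Chern connection of H. The first
   condition is compatibility with the holomorphic structure, the second one is
   d/dz <xi, eta> = <nabla_z xi, eta> + <xi, nabla_zbar eta>. *)
Definition chern_connection (H a b : Mfun) : Prop :=
  (forall z, b z = 0) /\
  (forall z, dz_mx H z = H z *m a z + adjmx (b z) *m H z).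

(* Coefficient of dz /\ dzbar in the curvature of d + a dz + b dzbar. *)
Definition curvature (a b : Mfun) (z : R[i]) : 'M[R[i]]_m :=
  dz_mx b z - dzbar_mx a z + a z *m b z - b z *m a z.

(* <K xi, xi> (s, sbar) > 0 for s = c d/dz. *)
Definition griffiths_positive_metric (H : Mfun) : Prop :=
  exists a b, chern_connection H a b /\
    forall z (c : R[i]) (xi : 'cV[R[i]]_m), c != 0 -> xi != 0 ->
      0 < (c * conjc c) * (adjmx xi *m H z *m (curvature a b z *m xi)) 0 0.

Definition griffiths_positive (g : Mfun) : Prop :=
  exists H0 H1 : Mfun,
    [/\ hermitian_metric H0, hermitian_metric H1,
        forall z, z != 0 -> H1 z^-1 = adjmx (g z) *m H0 z *m g z,
        griffiths_positive_metric H0 & griffiths_positive_metric H1].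

(* E^D, by its clutching function; z is the coordinate on the disc and w the
   holomorphic coordinate on the conjugate disc. *)
Definition doubled_bundle (kappa : 'I_m -> int) : Mfun := Lambda kappa.

(* In the trivializations of E by Theta^-1 and of its conjugate by the inverse
   of the conjugate of Theta, this clutching function identifies the conjugate
   of f with f, for every f in F. *)
Lemma doubled_bundle_glue alpha tau Theta kappa (t : R) f :
  maslov_factorization alpha tau Theta kappa -> tau (cis t) f ->
  Theta (cis t) *m doubled_bundle kappa (cis t)
    *m invmx (map_mx (@conjc R) (Theta (cis t))) *m map_mx (@conjc R) f = f.
Proof.
case=> Tu _ _ _ tauE; rewrite tauE => -[r _ <-].
have Tct : Theta (cis t) \in unitmx.
  by apply: Tu; rewrite /udisc/= /cabs normc_def/= cos2Dsin2 sqrtr1.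
rewrite !map_mxM -!mulmxA mulKmx ?map_unitmx//.
have -> : map_mx (@conjc R) (map_mx (real_complex R) r)
          = map_mx (real_complex R) r.
  by apply/matrixP => i j; rewrite !mxE; exact: conjc_real.
congr (_ *m _); rewrite mulmxA; congr (_ *m _).
rewrite /doubled_bundle /Lambda /Lambda_half map_diag_mx mulmx_diag.
congr diag_mx; apply/rowP => j; rewrite !mxE.
rewrite [X in _ * X](conjc_cis ((kappa j)%:~R * t / 2)) cisX -cisD.
by congr (cis _); rewrite [X in X - _]splitr addrK.
Qed.

End BundlesOnSphere.

(* Main.v *)
(* The partial Maslov indices enter E^D only through its clutching function, so
   the claim is that the sum of the O(kappa_j) is Griffiths positive exactly when
   every kappa_j is positive.

   If they are positive, the Fubini-Study metrics (1 + |z|^2)^(- kappa_j) work.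

   Conversely, if kappa_j <= 0, the dual of the summand O(kappa_j) gives a nonzero
   holomorphic section of the dual of E^D. Griffiths positivity of E^D makes the
   dual negative, so the squared norm G_jj of this section, with G = H^-1, is
   strictly subharmonic where the section does not vanish:
     d_zbar d_z G = K G + a G a^*.
   This contradicts the existence of a maximum on the sphere. *)

Require Import Defs.
From HB Require Import structures.
From mathcomp Require Import all_boot all_order all_algebra.
From mathcomp Require Import all_classical all_reals all_analysis.
From mathcomp Require Import complex ring lra.
Set Implicit Arguments.
Unset Strict Implicit.
Import Order.TTheory GRing.Theory Num.Theory.
Import numFieldNormedType.Exports.
Local Open Scope classical_set_scope.
Local Open Scope complex_scope.
Local Open Scope ring_scope.

(** * Smooth real-valued functions on a normed space *)

Section SmoothFunctions.
Context {R : realType} {E : normedModType R}.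
Implicit Types f g : E -> R.

Lemma smooth_continuous f : smooth_on setT f -> continuous f.
Proof. by move=> /(_ 0)[+ _] p => /(_ p I). Qed.

Lemma smooth_derivable f : smooth_on setT f -> forall p v, derivable f p v.
Proof. by move=> /(_ 1)[_ [+ _]] p v => /(_ p v I). Qed.

Lemma smooth_derive f v : smooth_on setT f -> smooth_on setT (fun x => 'D_v f x).
Proof. by move=> sf k; have [_ [_ +]] := sf k.+1 => /(_ v). Qed.

Lemma smooth_cst (c : R) : smooth_on setT (cst c : E -> R).
Proof.
move=> k; elim: k c => [|k IH] c /=.
  by split => // x _; exact: cst_continuous.
split; first by move=> x _; exact: cst_continuous.
split; first by move=> x v _; exact: derivable_cst.
move=> v; suff -> : (fun x => 'D_v (cst c) x) = cst (0 : R) by exact: IH.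
by apply/funext => x; rewrite derive_cst.
Qed.

Lemma CkW k f : Ck k.+1 setT f -> Ck k setT f.
Proof.
elim: k f => [|k IH] f [cf [df Df]]; first by split.
by split => //; split => // v; exact/IH/Df.
Qed.

Lemma CkD k f g : Ck k setT f -> Ck k setT g -> Ck k setT (f + g).
Proof.
elim: k f g => [|k IH] f g.
  by move=> [cf _] [cg _]; split=> // x _; apply: continuousD; [exact: cf|exact: cg].
move=> [cf [df Df]] [cg [dg Dg]]; split.
  by move=> x _; apply: continuousD; [exact: cf|exact: cg].
split; first by move=> x v _; apply: derivableD; [exact: df|exact: dg].
move=> v.
have -> : (fun x => 'D_v (f + g) x) = (fun x => 'D_v f x) + (fun x => 'D_v g x).
  by apply/funext => x; rewrite deriveD//; [exact: df|exact: dg].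
by apply: IH; [exact: Df|exact: Dg].
Qed.

(** The Leibniz rule multiplies a derivative of order k by the other factor, which has order k + 1;
    [CkW] lowers the latter so that the induction hypothesis fits both. *)
Lemma CkM k f g : Ck k setT f -> Ck k setT g -> Ck k setT (f * g).
Proof.
elim: k f g => [|k IH] f g.
  by move=> [cf _] [cg _]; split=> // x _; apply: continuousM; [exact: cf|exact: cg].
move=> kf kg; have [cf [df Df]] := kf; have [cg [dg Dg]] := kg; split.
  by move=> x _; apply: continuousM; [exact: cf|exact: cg].
split; first by move=> x v _; apply: derivableM; [exact: df|exact: dg].
move=> v.
have -> : (fun x => 'D_v (f * g) x)
    = f * (fun x => 'D_v g x) + g * (fun x => 'D_v f x).
  by apply/funext => x; rewrite deriveM//; [exact: df|exact: dg].
by apply: CkD; apply: IH; [exact: CkW|exact: Dg|exact: CkW|exact: Df].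
Qed.

(** The derivative - f' / f ^ 2 involves f only through f' and f^-1, and the induction hypothesis
    already makes f^-1 of class C^k. *)
Lemma CkV k f : (forall x, f x != 0) -> Ck k setT f ->
  Ck k setT (fun x => (f x)^-1).
Proof.
move=> f0; elim: k f f0 => [|k IH] f f0.
  by move=> [cf _]; split=> // x _; apply: continuousV => //; exact: cf.
move=> kf; have [cf [df Df]] := kf; split.
  by move=> x _; apply: continuousV => //; exact: cf.
split; first by move=> x v _; apply: derivableV => //; exact: df.
move=> v.
have -> : (fun x => 'D_v (fun x => (f x)^-1) x)
    = cst (-1) * ((fun x => (f x)^-1) * ((fun x => (f x)^-1) * (fun x => 'D_v f x))).
  apply/funext => x; rewrite deriveV//; last exact: df.
  by rewrite /GRing.mul/= mulN1r /GRing.scale/= expr2 invfM mulrA mulNr.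
apply: CkM; first exact: smooth_cst.
have kV : Ck k setT (fun x => (f x)^-1) by apply: IH => //; exact: CkW.
by apply: CkM => //; apply: CkM => //; exact: Df.
Qed.

Lemma smoothD f g : smooth_on setT f -> smooth_on setT g -> smooth_on setT (f + g).
Proof. by move=> sf sg k; exact: CkD. Qed.

Lemma smoothM f g : smooth_on setT f -> smooth_on setT g -> smooth_on setT (f * g).
Proof. by move=> sf sg k; exact: CkM. Qed.

Lemma smoothV f : (forall x, f x != 0) -> smooth_on setT f ->
  smooth_on setT (fun x => (f x)^-1).
Proof. by move=> f0 sf k; exact: CkV. Qed.

Lemma smoothN f : smooth_on setT f -> smooth_on setT (- f).
Proof.
move=> sf; have -> : - f = cst (-1) * f by apply/funext => x; rewrite /GRing.mul/= mulN1r.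
by apply: smoothM => //; exact: smooth_cst.
Qed.

(** Meant for the coordinate functions: each first derivative is constant in the point, so the
    higher ones vanish. *)
Lemma smooth_of_derive_cst f (c : E -> R) : continuous f ->
  (forall x v, is_derive x v f (c v)) -> smooth_on setT f.
Proof.
move=> cf df [|k]; split => //; first by move=> x _; exact: cf.
  by move=> x _; exact: cf.
split => [x v _|v]; first by have [] := df x v.
suff -> : (fun x => 'D_v f x) = cst (c v) by exact: smooth_cst.
by apply/funext => x; have [_ ->] := df x v.
Qed.

End SmoothFunctions.

(** * Coordinates of the real plane *)

Section PlaneCoordinates.
Context {R : realType}.

Lemma is_derive_fst (p v : R * R) : is_derive p v (@fst R R) v.1.
Proof.
have cfst : continuous (@fst R R : R * R -> R) by move=> q; exact: cvg_fst.
have dp : differentiable (@fst R R : R * R -> R) p by exact: linear_differentiable.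
apply: DeriveDef; first exact/diff_derivable.
by rewrite deriveE// (@diff_lin _ _ _ (@fst R R)).
Qed.

Lemma is_derive_snd (p v : R * R) : is_derive p v (@snd R R) v.2.
Proof.
have csnd : continuous (@snd R R : R * R -> R) by move=> q; exact: cvg_snd.
have dp : differentiable (@snd R R : R * R -> R) p by exact: linear_differentiable.
apply: DeriveDef; first exact/diff_derivable.
by rewrite deriveE// (@diff_lin _ _ _ (@snd R R)).
Qed.

Lemma smooth_fst : smooth_on setT (@fst R R).
Proof.
apply: (@smooth_of_derive_cst _ _ _ fst); last exact: is_derive_fst.
by move=> p; exact: cvg_fst.
Qed.

Lemma smooth_snd : smooth_on setT (@snd R R).
Proof.
apply: (@smooth_of_derive_cst _ _ _ snd); last exact: is_derive_snd.
by move=> p; exact: cvg_snd.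
Qed.

End PlaneCoordinates.

(** * Second derivative test at a maximum *)

Section SecondDerivativeTest.
Context {R : realType}.

(** If c were positive, [df] would vanish at 0 and be positive just after it, so [f] would exceed
    its maximum by the mean value theorem. *)
Lemma second_derive_at_max (f df : R -> R) (c : R) :
  (forall t : R, is_derive t 1 f (df t)) -> is_derive (0 : R) 1 df c ->
  (forall t, f t <= f 0) -> c <= 0.
Proof.
move=> fE dfE fmax.
have df0 : df 0 = 0.
  have [_ <-] := fE 0.
  have [] // : is_derive (0 : R) 1 f 0.
  apply: (@derive1_at_max _ f (-1) 1 0) => //.
  by rewrite in_itv/=; apply/andP; split; lra.
rewrite leNgt; apply/negP => c0.
have [ddf dc] := dfE.
(* The difference quotients of [df] at 0 tend to c > 0, so they are positive on some punctured ball
   of radius [e]. *)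
have : (fun h : R => h^-1 *: (df (h *: 1 + 0) - df 0)) @ 0^' --> c.
  by rewrite -dc; exact: ddf.
move=> /cvgr_gt /(_ _ c0) /nbhs_ballP[e /= e0 He].
have He' h : 0 < h -> h < e -> 0 < df h.
  move=> h0 he; have /= := He h; rewrite /ball/= sub0r normrN gtr0_norm//.
  move=> /(_ he); rewrite gt_eqF// df0 subr0 addr0 /GRing.scale/= mulr1.
  by move=> /(_ isT); rewrite pmulr_rgt0// invr_gt0.
(* Half the radius keeps the intermediate point strictly inside the ball where [df] is known to be
   positive. *)
have e20 : 0 < e / 2 by rewrite divr_gt0.
have cf : {within `[0, e / 2], continuous f}.
  apply: derivable_within_continuous => t _; by have [] := fE t.
have [t /[!in_itv]/= /andP[t0 te]] := MVT e20 (fun t _ => fE t) cf.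
move=> fte; have := fmax (e / 2); rewrite -subr_le0 fte subr0.
rewrite leNgt mulr_gt0// He'//; apply: (lt_trans te).
by rewrite ltr_pdivrMr// mulr_natr mulr2n ltrDl.
Qed.

(** The difference quotients of [f] along v and of its restriction to the line are the same function
    of h. *)
Lemma is_derive_line (E : normedModType R) (f : E -> R) (p v : E) (t : R) :
  derivable f (t *: v + p) v ->
  is_derive t 1 (fun s => f (s *: v + p)) ('D_v f (t *: v + p)).
Proof.
move=> df; have quotE : (fun h : R => h^-1 *:
      (((fun s => f (s *: v + p)) \o shift t) (h *: 1) - f (t *: v + p))) =
    (fun h => h^-1 *: ((f \o shift (t *: v + p)) (h *: v) - f (t *: v + p))).
  apply/funext => h /=; rewrite addrA; congr (_ *: (f (_ + _) - _)).
  by rewrite -scalerDl; congr ((_ + _) *: _); rewrite /GRing.scale/= mulr1.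
by apply: DeriveDef; rewrite /derivable /derive quotE.
Qed.

(** The restriction of [f] to the line through p with direction v has its maximum at parameter 0,
    where the one-variable test applies. *)
Lemma derive2_at_max (E : normedModType R) (f : E -> R) (p v : E) :
  smooth_on setT f -> (forall q, f q <= f p) ->
  'D_v (fun q => 'D_v f q) p <= 0.
Proof.
move=> sf fmax.
have D0 : 0 *: v + p = p by rewrite scale0r add0r.
apply: (@second_derive_at_max (fun t => f (t *: v + p))
  (fun t => 'D_v f (t *: v + p))).
- by move=> t; apply: is_derive_line; exact: smooth_derivable.
- have := @is_derive_line _ (fun q => 'D_v f q) p v 0.
  rewrite D0; apply; apply: smooth_derivable; exact: smooth_derive.
- by move=> t; rewrite D0.
Qed.

End SecondDerivativeTest.

(** * Leibniz rule for the real and imaginary parts of a product *)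

Section DeriveComplexProduct.
Context {R : realType} {E : normedModType R} {f1 f2 g1 g2 : E -> R} {x v : E}.
Hypotheses (df1 : derivable f1 x v) (df2 : derivable f2 x v).
Hypotheses (dg1 : derivable g1 x v) (dg2 : derivable g2 x v).

Lemma derive_re_mul : 'D_v (f1 * g1 - f2 * g2) x =
  'D_v f1 x * g1 x - 'D_v f2 x * g2 x + (f1 x * 'D_v g1 x - f2 x * 'D_v g2 x).
Proof.
have -> := deriveB (derivableM df1 dg1) (derivableM df2 dg2).
have -> := deriveM df1 dg1; have -> := deriveM df2 dg2.
by rewrite /GRing.scale/= (mulrC (g1 x)) (mulrC (g2 x)) opprD addrACA addrC.
Qed.

Lemma derive_im_mul : 'D_v (f1 * g2 + f2 * g1) x =
  'D_v f1 x * g2 x + 'D_v f2 x * g1 x + (f1 x * 'D_v g2 x + f2 x * 'D_v g1 x).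
Proof.
have -> := deriveD (derivableM df1 dg2) (derivableM df2 dg1).
have -> := deriveM df1 dg2; have -> := deriveM df2 dg1.
by rewrite /GRing.scale/= (mulrC (g2 x)) (mulrC (g1 x)) addrACA addrC.
Qed.

End DeriveComplexProduct.

(** * Smooth complex-valued functions of z and their real partial derivatives *)

Section ComplexSmooth.
Context {R : realType}.
Implicit Types (f g : R[i] -> R[i]) (z v c : R[i]).

Lemma ReD (x y : R[i]) : complex.Re (x + y) = complex.Re x + complex.Re y.
Proof. by case: x y => ? ? [? ?]. Qed.

Lemma ImD (x y : R[i]) : complex.Im (x + y) = complex.Im x + complex.Im y.
Proof. by case: x y => ? ? [? ?]. Qed.

Lemma ReM (x y : R[i]) : complex.Re (x * y) =
  complex.Re x * complex.Re y - complex.Im x * complex.Im y.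
Proof. by case: x y => ? ? [? ?]. Qed.

Lemma ImM (x y : R[i]) : complex.Im (x * y) =
  complex.Re x * complex.Im y + complex.Im x * complex.Re y.
Proof. by case: x y => ? ? [? ?]. Qed.

Lemma ReJ (x : R[i]) : complex.Re (conjc x) = complex.Re x.
Proof. by case: x. Qed.

Lemma ImJ (x : R[i]) : complex.Im (conjc x) = - complex.Im x.
Proof. by case: x. Qed.

Lemma plK : cancel (@pl R) cx. Proof. by case. Qed.
Lemma cxK : cancel (@cx R) pl. Proof. by case. Qed.

(** Smoothness in the real sense, not holomorphy; entrywise, it is the regularity demanded by
    [hermitian_metric]. *)
Definition csmooth f :=
  smooth_on setT ((fun z => complex.Re (f z)) \o cx) /\
  smooth_on setT ((fun z => complex.Im (f z)) \o cx).

Lemma csmooth_cst c : csmooth (fun=> c).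
Proof. by split; exact: smooth_cst. Qed.

Lemma csmooth_id : csmooth id.
Proof. by split; [exact: smooth_fst|exact: smooth_snd]. Qed.

Lemma csmoothD f g : csmooth f -> csmooth g -> csmooth (fun z => f z + g z).
Proof.
move=> [f1 f2] [g1 g2]; split.
- have -> : (fun z => complex.Re (f z + g z)) \o cx =
      ((fun z => complex.Re (f z)) \o cx) + ((fun z => complex.Re (g z)) \o cx).
    by apply/funext => p /=; rewrite ReD.
  exact: smoothD.
- have -> : (fun z => complex.Im (f z + g z)) \o cx =
      ((fun z => complex.Im (f z)) \o cx) + ((fun z => complex.Im (g z)) \o cx).
    by apply/funext => p /=; rewrite ImD.
  exact: smoothD.
Qed.

Lemma csmoothM f g : csmooth f -> csmooth g -> csmooth (fun z => f z * g z).
Proof.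
move=> [f1 f2] [g1 g2]; split.
- have -> : (fun z => complex.Re (f z * g z)) \o cx =
      ((fun z => complex.Re (f z)) \o cx) * ((fun z => complex.Re (g z)) \o cx)
      + - (((fun z => complex.Im (f z)) \o cx) * ((fun z => complex.Im (g z)) \o cx)).
    by apply/funext => p /=; rewrite ReM.
  by apply: smoothD; [exact: smoothM|apply: smoothN; exact: smoothM].
- have -> : (fun z => complex.Im (f z * g z)) \o cx =
      ((fun z => complex.Re (f z)) \o cx) * ((fun z => complex.Im (g z)) \o cx)
      + ((fun z => complex.Im (f z)) \o cx) * ((fun z => complex.Re (g z)) \o cx).
    by apply/funext => p /=; rewrite ImM.
  by apply: smoothD; exact: smoothM.
Qed.

Lemma csmooth_conj f : csmooth f -> csmooth (fun z => conjc (f z)).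
Proof.
move=> [f1 f2]; split.
- suff -> : (fun z => complex.Re (conjc (f z))) = (fun z => complex.Re (f z)) by [].
  by apply/funext => z; rewrite ReJ.
- have -> : (fun z => complex.Im (conjc (f z))) \o cx
      = - ((fun z => complex.Im (f z)) \o cx).
    by apply/funext => p /=; rewrite ImJ.
  exact: smoothN.
Qed.

(** Since 1 / f is the conjugate of f divided by the real function |f|^2, inversion reduces to that
    of a nowhere zero real function. *)
Lemma csmoothV f : (forall z, f z != 0) -> csmooth f -> csmooth (fun z => (f z)^-1).
Proof.
move=> f0 sf.
pose N z := f z * conjc (f z).
have [sN _] : csmooth N by apply: csmoothM => //; exact: csmooth_conj.
have NE z : N z = (complex.Re (N z))%:C.
  by rewrite /N; case: (f z) => a b; apply/eqP; rewrite eq_complex/= eqxx/= mulrN mulrC addNr.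
have ReN0 p : complex.Re (N (cx p)) != 0.
  apply/eqP => N0; have := NE (cx p); rewrite N0 /N => /eqP.
  by rewrite mulf_eq0 conjc_eq0 (negbTE (f0 _)).
have -> : (fun z => (f z)^-1)
    = (fun z => conjc (f z) * ((complex.Re (N z))^-1)%:C).
  apply/funext => z; apply: (mulfI (f0 z)).
  rewrite mulfV// mulrA -/(N z) [X in X * _]NE -rmorphM/= mulfV//.
  by have := ReN0 (pl z); rewrite plK.
apply: csmoothM; first exact: csmooth_conj.
by split; [exact: (smoothV ReN0 sN)|exact: smooth_cst].
Qed.

Lemma csmooth_sum (I : Type) (r : seq I) (P : pred I) (F : I -> R[i] -> R[i]) :
  (forall i, csmooth (F i)) -> csmooth (fun z => \sum_(i <- r | P i) F i z).
Proof.
move=> sF; elim: r => [|i r IH].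
  suff -> : (fun z => \sum_(i <- [::] | P i) F i z) = (fun=> 0) by exact: csmooth_cst.
  by apply/funext => z; rewrite big_nil.
have [Pi|Pi] := boolP (P i).
  have -> : (fun z => \sum_(i <- i :: r | P i) F i z) =
      (fun z => F i z + \sum_(i <- r | P i) F i z).
    by apply/funext => z; rewrite big_cons Pi.
  exact: csmoothD.
suff -> : (fun z => \sum_(i <- i :: r | P i) F i z) =
      (fun z => \sum_(i <- r | P i) F i z) by [].
by apply/funext => z; rewrite big_cons (negbTE Pi).
Qed.

Lemma csmooth_prod (I : Type) (r : seq I) (F : I -> R[i] -> R[i]) :
  (forall i, csmooth (F i)) -> csmooth (fun z => \prod_(i <- r) F i z).
Proof.
move=> sF; elim: r => [|i r IH].
  suff -> : (fun z => \prod_(i <- [::]) F i z) = (fun=> 1) by exact: csmooth_cst.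
  by apply/funext => z; rewrite big_nil.
have -> : (fun z => \prod_(i <- i :: r) F i z) =
    (fun z => F i z * \prod_(i <- r) F i z).
  by apply/funext => z; rewrite big_cons.
exact: csmoothM.
Qed.

Lemma csmoothX f n : csmooth f -> csmooth (fun z => f z ^+ n).
Proof.
move=> sf; elim: n => [|n IH]; first exact: csmooth_cst.
have -> : (fun z => f z ^+ n.+1) = (fun z => f z * f z ^+ n).
  by apply/funext => z; rewrite exprS.
exact: csmoothM.
Qed.

Lemma csmooth_deriv_c f v : csmooth f -> csmooth (deriv_c f v).
Proof.
move=> [f1 f2]; split.
- have -> : (fun z => complex.Re (deriv_c f v z)) \o cx
      = (fun p => 'D_(pl v) ((fun z => complex.Re (f z)) \o cx) p).
    by apply/funext => p; rewrite /= /real_deriv cxK.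
  exact: smooth_derive.
- have -> : (fun z => complex.Im (deriv_c f v z)) \o cx
      = (fun p => 'D_(pl v) ((fun z => complex.Im (f z)) \o cx) p).
    by apply/funext => p; rewrite /= /real_deriv cxK.
  exact: smooth_derive.
Qed.

Lemma deriv_c_cst c v z : deriv_c (fun=> c) v z = 0.
Proof.
by apply/eqP; rewrite eq_complex/= /real_deriv !derive_cst eqxx.
Qed.

Lemma deriv_cD f g v z : csmooth f -> csmooth g ->
  deriv_c (fun z => f z + g z) v z = deriv_c f v z + deriv_c g v z.
Proof.
move=> [f1 f2] [g1 g2]; apply/eqP; rewrite eq_complex/= /real_deriv.
have -> : (fun z => complex.Re (f z + g z)) \o cx =
      ((fun z => complex.Re (f z)) \o cx) + ((fun z => complex.Re (g z)) \o cx).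
  by apply/funext => p /=; rewrite ReD.
have -> : (fun z => complex.Im (f z + g z)) \o cx =
      ((fun z => complex.Im (f z)) \o cx) + ((fun z => complex.Im (g z)) \o cx).
  by apply/funext => p /=; rewrite ImD.
by rewrite !deriveD ?eqxx//; exact: smooth_derivable.
Qed.

Lemma deriv_cM f g v z : csmooth f -> csmooth g ->
  deriv_c (fun z => f z * g z) v z = deriv_c f v z * g z + f z * deriv_c g v z.
Proof.
move=> [f1 f2] [g1 g2].
have {}f1 := smooth_derivable f1 (p := pl z) (v := pl v).
have {}f2 := smooth_derivable f2 (p := pl z) (v := pl v).
have {}g1 := smooth_derivable g1 (p := pl z) (v := pl v).
have {}g2 := smooth_derivable g2 (p := pl z) (v := pl v).
rewrite /deriv_c /real_deriv.
have -> : (fun z => complex.Re (f z * g z)) \o cx =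
      ((fun z => complex.Re (f z)) \o cx) * ((fun z => complex.Re (g z)) \o cx)
      - (((fun z => complex.Im (f z)) \o cx) * ((fun z => complex.Im (g z)) \o cx)).
  by apply/funext => p /=; rewrite ReM.
have -> : (fun z => complex.Im (f z * g z)) \o cx =
      ((fun z => complex.Re (f z)) \o cx) * ((fun z => complex.Im (g z)) \o cx)
      + ((fun z => complex.Im (f z)) \o cx) * ((fun z => complex.Re (g z)) \o cx).
  by apply/funext => p /=; rewrite ImM.
rewrite (derive_re_mul f1 f2 g1 g2) (derive_im_mul f1 f2 g1 g2).
by apply/eqP; rewrite eq_complex ReD ImD !ReM !ImM /= plK !eqxx.
Qed.

Lemma deriv_c_conj f v z : csmooth f ->
  deriv_c (fun z => conjc (f z)) v z = conjc (deriv_c f v z).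
Proof.
move=> [f1 f2]; rewrite /deriv_c /real_deriv.
have -> : (fun z => complex.Re (conjc (f z))) = (fun z => complex.Re (f z)).
  by apply/funext => w; rewrite ReJ.
have -> : (fun z => complex.Im (conjc (f z))) \o cx
      = - ((fun z => complex.Im (f z)) \o cx).
  by apply/funext => p /=; rewrite ImJ.
by rewrite deriveN//; exact: smooth_derivable.
Qed.

Lemma deriv_c_id v z : deriv_c id v z = v.
Proof.
rewrite /deriv_c /real_deriv.
have [_ D1] := is_derive_fst (pl z) (pl v).
have [_ D2] := is_derive_snd (pl z) (pl v).
rewrite [X in X +i* _]D1 [X in _ +i* X]D2.
by case: v {D1 D2}.
Qed.

End ComplexSmooth.

(** * Wirtinger derivatives as derivations *)

Section Derivations.
Context {R : realType}.
Notation C := R[i].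
Implicit Types (f g : C -> C) (z c : C).

(** What [dz] and [dzbar] have in common, so that the matrix calculus is done once for both. *)
Definition derivation (D : (C -> C) -> C -> C) : Prop :=
  [/\ forall c z, D (fun=> c) z = 0,
      forall f, csmooth f -> csmooth (D f),
      forall f g z, csmooth f -> csmooth g ->
        D (fun w => f w + g w) z = D f z + D g z &
      forall f g z, csmooth f -> csmooth g ->
        D (fun w => f w * g w) z = D f z * g z + f z * D g z].

(** The constant c is - i for [dz] and i for [dzbar]. *)
Lemma derivation_wirtinger c :
  derivation (fun f z => (deriv_c f 1 z + c * deriv_c f iunit z) / 2).
Proof.
split.
- by move=> d z; rewrite !deriv_c_cst mulr0 addr0 mul0r.
- move=> f sf; apply: csmoothM; last exact: csmooth_cst.
  apply: csmoothD; first exact: csmooth_deriv_c.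
  by apply: csmoothM; [exact: csmooth_cst|exact: csmooth_deriv_c].
- by move=> f g z sf sg; rewrite !deriv_cD// mulrDr addrACA mulrDl.
- move=> f g z sf sg; rewrite !deriv_cM//.
  move: (deriv_c f 1 z) (deriv_c g 1 z) (deriv_c f iunit z) (deriv_c g iunit z).
  by move: (f z) (g z) 2^-1 => u v h p q r s; ring.
Qed.

Lemma derivation_dz : derivation dz.
Proof.
rewrite [X in derivation X](_ : _ =
  fun f z => (deriv_c f 1 z + (- iunit) * deriv_c f iunit z) / 2).
  exact: derivation_wirtinger.
by apply/funext => f; apply/funext => z; rewrite mulNr.
Qed.

Lemma derivation_dzbar : derivation dzbar.
Proof. exact: derivation_wirtinger. Qed.

Lemma iunit2 : iunit * iunit = -1 :> C.
Proof. by rewrite -expr2 sqr_i. Qed.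

Lemma half_sum (c : C) : (c + c) / 2 = c.
Proof. by rewrite -mulr2n -(mulr_natr c) mulfK// pnatr_eq0. Qed.

Lemma dz_id z : dz id z = 1.
Proof. by rewrite /dz !deriv_c_id iunit2 opprK half_sum. Qed.

Lemma dzbar_id z : dzbar id z = 0.
Proof. by rewrite /dzbar !deriv_c_id iunit2 subrr mul0r. Qed.

Lemma conjcM (x y : C) : conjc (x * y) = conjc x * conjc y.
Proof. exact: rmorphM. Qed.

Lemma conjcD (x y : C) : conjc (x + y) = conjc x + conjc y.
Proof. exact: rmorphD. Qed.

Lemma conjcB (x y : C) : conjc (x - y) = conjc x - conjc y.
Proof. exact: rmorphB. Qed.

Lemma conjc_half (x : C) : conjc (x / 2) = conjc x / 2.
Proof. by rewrite conjcM conjc_inv conjc_nat. Qed.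

Lemma conjc_iunit : conjc iunit = - iunit :> C.
Proof. by apply/eqP; rewrite eq_complex/= oppr0 !eqxx. Qed.

Lemma dz_conj f z : csmooth f -> dz (fun w => conjc (f w)) z = conjc (dzbar f z).
Proof.
move=> sf; rewrite /dz /dzbar !deriv_c_conj// conjc_half conjcD.
by rewrite [in RHS]conjcM conjc_iunit mulNr.
Qed.

Lemma dzbar_conj f z : csmooth f -> dzbar (fun w => conjc (f w)) z = conjc (dz f z).
Proof.
move=> sf; rewrite /dz /dzbar !deriv_c_conj// conjc_half conjcB.
by rewrite [in RHS]conjcM conjc_iunit mulNr opprK.
Qed.

End Derivations.

(** * Calculus of matrix-valued functions *)

Section SmoothMatrices.
Context {R : realType}.
Notation C := R[i].

Definition msmooth m n (A : C -> 'M[C]_(m, n)) := forall i j, csmooth (fun z => A z i j).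

Lemma msmoothM m n p (A : C -> 'M[C]_(m, n)) (B : C -> 'M[C]_(n, p)) :
  msmooth A -> msmooth B -> msmooth (fun z => A z *m B z).
Proof.
move=> sA sB i j.
have -> : (fun z => (A z *m B z) i j) = (fun z => \sum_k (A z i k * B z k j)).
  by apply/funext => z; rewrite mxE.
by apply: csmooth_sum => k; exact: csmoothM.
Qed.

Lemma csmooth_det n (A : C -> 'M[C]_n) : msmooth A -> csmooth (fun z => \det (A z)).
Proof.
move=> sA; apply: csmooth_sum => s.
by apply: csmoothM; [exact: csmooth_cst|exact: csmooth_prod].
Qed.

(** Cramer's rule: the entries of the inverse are signed minors divided by the determinant, hence
    rational in the entries of A. *)
Lemma msmooth_inv n (A : C -> 'M[C]_n) : (forall z, A z \in unitmx) ->
  msmooth A -> msmooth (fun z => invmx (A z)).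
Proof.
move=> Au sA i j.
have -> : (fun z => invmx (A z) i j) = (fun z => (\det (A z))^-1 *
    ((-1) ^+ (j + i) * \det (row' j (col' i (A z))))).
  by apply/funext => z; rewrite /invmx Au !mxE.
apply: csmoothM.
  apply: csmoothV; last exact: csmooth_det.
  by move=> z; rewrite -unitfE -unitmxE.
apply: csmoothM; first exact: csmooth_cst.
apply: csmooth_det => k l.
have -> : (fun z => row' j (col' i (A z)) k l) = (fun z => A z (lift j k) (lift i l)).
  by apply/funext => z; rewrite !mxE.
exact: sA.
Qed.

Definition der_mx D m n (A : C -> 'M[C]_(m, n)) (z : C) : 'M[C]_(m, n) :=
  \matrix_(i, j) D (fun w => A w i j) z.

Context {D : (C -> C) -> C -> C} (derD : derivation D).

Lemma msmooth_der_mx m n (A : C -> 'M[C]_(m, n)) :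
  msmooth A -> msmooth (der_mx D A).
Proof.
move=> sA i j; have [_ sD _ _] := derD.
have -> : (fun z => der_mx D A z i j) = D (fun w => A w i j).
  by apply/funext => z; rewrite mxE.
exact: sD.
Qed.

Lemma derivation_sum (I : Type) (r : seq I) (F : I -> C -> C) z :
  (forall i, csmooth (F i)) ->
  D (fun w => \sum_(i <- r) F i w) z = \sum_(i <- r) D (F i) z.
Proof.
move=> sF; have [D0 _ DD _] := derD; elim: r => [|i r IH].
  rewrite big_nil -[RHS](D0 0 z); congr (D _ z).
  by apply/funext => w; rewrite big_nil.
rewrite big_cons -IH -DD//; last exact: csmooth_sum.
by congr (D _ z); apply/funext => w; rewrite big_cons.
Qed.

Lemma derivationN f z : csmooth f -> D (fun w => - f w) z = - D f z.
Proof.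
move=> sf; have [D0 _ _ DM] := derD.
have -> : (fun w => - f w) = (fun w => -1 * f w) by apply/funext => w; rewrite mulN1r.
by rewrite DM//; [rewrite D0 mul0r add0r mulN1r|exact: csmooth_cst].
Qed.

Lemma der_mxM m n p (A : C -> 'M[C]_(m, n)) (B : C -> 'M[C]_(n, p)) z :
  msmooth A -> msmooth B ->
  der_mx D (fun w => A w *m B w) z = der_mx D A z *m B z + A z *m der_mx D B z.
Proof.
move=> sA sB; have [_ _ _ DM] := derD; apply/matrixP => i j; rewrite !mxE.
have -> : (fun w => (A w *m B w) i j) = (fun w => \sum_k (A w i k * B w k j)).
  by apply/funext => w; rewrite mxE.
rewrite derivation_sum => [|k]; last exact: csmoothM.
by rewrite -big_split; apply: eq_bigr => k _ /=; rewrite DM// !mxE.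
Qed.

Lemma der_mxN m n (A : C -> 'M[C]_(m, n)) z :
  msmooth A -> der_mx D (fun w => - A w) z = - der_mx D A z.
Proof.
move=> sA; apply/matrixP => i j; rewrite !mxE -derivationN//.
by congr (D _ z); apply/funext => w; rewrite mxE.
Qed.

(** Differentiate the constant product of A^-1 and A and solve for the derivative of A^-1. *)
Lemma der_mx_inv n (A : C -> 'M[C]_n) z :
  (forall w, A w \in unitmx) -> msmooth A ->
  der_mx D (fun w => invmx (A w)) z = - (invmx (A z) *m der_mx D A z *m invmx (A z)).
Proof.
move=> Au sA; have [D0 _ _ _] := derD.
have sV := msmooth_inv Au sA.
have : der_mx D (fun w => invmx (A w) *m A w) z = 0.
  apply/matrixP => i j; rewrite !mxE -[RHS](D0 ((1%:M : 'M[C]_n) i j) z).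
  by congr (D _ z); apply/funext => w; rewrite mulVmx.
rewrite der_mxM// => /eqP; rewrite addr_eq0 => /eqP h.
by rewrite -[LHS](mulmxK (Au z)) h mulNmx.
Qed.

End SmoothMatrices.

(** * Conjugate transpose *)

Section Adjoint.
Context {R : realType}.
Notation C := R[i].

Lemma adjmxK m n (A : 'M[C]_(m, n)) : adjmx (adjmx A) = A.
Proof. by apply/matrixP => i j; rewrite !mxE conjcK. Qed.

Lemma adjmxM m n p (A : 'M[C]_(m, n)) (B : 'M[C]_(n, p)) :
  adjmx (A *m B) = adjmx B *m adjmx A.
Proof. by rewrite /adjmx map_mxM trmx_mul. Qed.

Lemma adjmxN m n (A : 'M[C]_(m, n)) : adjmx (- A) = - adjmx A.
Proof. by apply/matrixP => i j; rewrite !mxE rmorphN. Qed.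

Lemma adjmx_inv n (A : 'M[C]_n) : adjmx (invmx A) = invmx (adjmx A).
Proof. by rewrite /adjmx map_invmx trmx_inv. Qed.

Lemma dzbar_mx_adj n (A : C -> 'M[C]_n) z : msmooth A ->
  dzbar_mx (fun w => adjmx (A w)) z = adjmx (dz_mx A z).
Proof.
move=> sA; apply/matrixP => i j; rewrite !mxE -dzbar_conj//.
by congr (dzbar _ z); apply/funext => w; rewrite !mxE.
Qed.

End Adjoint.

(** * Hermitian metrics, their duals and the Chern curvature *)

Section HermitianMetrics.
Context {R : realType} {m : nat}.
Notation C := R[i].
Variables (H : C -> 'M[C]_m) (hH : hermitian_metric H).

Lemma metric_smooth : msmooth H.
Proof. by case: hH. Qed.

Lemma metric_adj z : adjmx (H z) = H z.
Proof. by have [_ /(_ z)[]] := hH. Qed.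

Lemma metric_gt0 z (xi : 'cV[C]_m) : xi != 0 -> 0 < (adjmx xi *m H z *m xi) 0 0.
Proof. by have [_ /(_ z)[_]] := hH; exact. Qed.

Lemma metric_ge0 z (xi : 'cV[C]_m) : 0 <= (adjmx xi *m H z *m xi) 0 0.
Proof.
have [->|xi0] := eqVneq xi 0; first by rewrite mulmx0 mxE.
exact/ltW/metric_gt0.
Qed.

(** A row vector in the left kernel of H would have an adjoint of norm zero. *)
Lemma metric_unit z : H z \in unitmx.
Proof.
rewrite unitmxE unitfE; apply/negP => /det0P[v v0 vH].
have /(metric_gt0 z) : adjmx v != 0.
  by apply: contra_neq v0 => v0; rewrite -[v]adjmxK v0; apply/matrixP => i j; rewrite !mxE conjc0.
by rewrite adjmxK vH mul0mx mxE ltxx.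
Qed.

(** Up to conjugation, the matrix of the metric induced on the dual bundle. *)
Let G z := invmx (H z).

Lemma dual_smooth : msmooth G.
Proof. by apply: msmooth_inv; [exact: metric_unit|exact: metric_smooth]. Qed.

Lemma dual_adj z : adjmx (G z) = G z.
Proof. by rewrite adjmx_inv metric_adj. Qed.

Lemma dual_neq0 z (xi : 'cV[C]_m) : xi != 0 -> G z *m xi != 0.
Proof.
by apply: contra_neq => h; rewrite -[xi](mulKVmx (metric_unit z)) h mulmx0.
Qed.

(** The form of G at xi equals the form of H at G xi, because G H G = G. *)
Lemma dual_gt0 z (xi : 'cV[C]_m) : xi != 0 -> 0 < (adjmx xi *m G z *m xi) 0 0.
Proof.
move=> /(dual_neq0 z)/(metric_gt0 z); rewrite adjmxM dual_adj.
by rewrite !mulmxA (mulmxKV (metric_unit z)).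
Qed.

Variables (a b : C -> 'M[C]_m) (ch : chern_connection H a b).

Lemma chern_b0 : b = (fun=> 0).
Proof. by apply/funext; case: ch. Qed.

Lemma chern_dz z : dz_mx H z = H z *m a z.
Proof. by have [_ ->] := ch; rewrite chern_b0 /adjmx map_mx0 trmx0 mul0mx addr0. Qed.

(** The classical formula H^-1 dH, which also shows that the connection form is smooth. *)
Lemma chern_a z : a z = G z *m dz_mx H z.
Proof. by rewrite chern_dz mulKmx// metric_unit. Qed.

Lemma chern_smooth : msmooth a.
Proof.
have -> : a = (fun z => G z *m dz_mx H z) by apply/funext => z; exact: chern_a.
apply: msmoothM; first exact: dual_smooth.
by apply: msmooth_der_mx; [exact: derivation_dz|exact: metric_smooth].
Qed.

Lemma chern_curvature z : curvature a b z = - dzbar_mx a z.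
Proof.
rewrite /curvature chern_b0 mulmx0 mul0mx subr0 addr0.
have [dz0 _ _ _] := @derivation_dz R.
suff -> : dz_mx (fun=> 0 : 'M[C]_m) z = 0 by rewrite add0r.
apply/matrixP => i j; rewrite !mxE -[RHS](dz0 0 z).
by congr (dz _ z); apply/funext => w; rewrite mxE.
Qed.

(** From the derivative of the inverse, - G (dz H) G, in which G (dz H) is [a]. *)
Lemma dz_dual z : dz_mx G z = - (a z *m G z).
Proof.
rewrite [LHS](der_mx_inv derivation_dz _ metric_unit metric_smooth).
by rewrite -[der_mx _ _ _]/(dz_mx H z) -/(G z) -chern_a.
Qed.

Lemma dzbar_dual z : dzbar_mx G z = - (G z *m adjmx (a z)).
Proof.
have -> : G = (fun w => adjmx (G w)) by apply/funext => w; rewrite dual_adj.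
by rewrite dzbar_mx_adj; [rewrite dz_dual adjmxN adjmxM dual_adj|exact: dual_smooth].
Qed.

(* The second term is the second fundamental form that makes the curvature of a
   quotient at least that of the bundle. *)
Lemma laplace_dual z : dzbar_mx (dz_mx G) z =
  curvature a b z *m G z + a z *m G z *m adjmx (a z).
Proof.
have -> : dz_mx G = (fun w => - (a w *m G w)) by apply/funext => w; exact: dz_dual.
have sa := chern_smooth; have sG := dual_smooth.
rewrite [LHS](der_mxN derivation_dzbar); last exact: msmoothM.
rewrite (der_mxM derivation_dzbar)//.
rewrite -[der_mx _ a z]/(dzbar_mx a z) -[der_mx _ G z]/(dzbar_mx G z).
by rewrite dzbar_dual chern_curvature mulNmx mulmxN opprD opprK mulmxA.
Qed.

Hypothesis Kpos : forall z (c : C) (xi : 'cV[C]_m), c != 0 -> xi != 0 ->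
  0 < (c * conjc c) * (adjmx xi *m H z *m (curvature a b z *m xi)) 0 0.

(** In [laplace_dual], the curvature term is the positive curvature form of H at G e, and the other
    term is the squared H-norm of G a^* e. *)
Lemma laplace_dual_gt0 z (e : 'cV[C]_m) : e != 0 ->
  0 < (adjmx e *m dzbar_mx (dz_mx G) z *m e) 0 0.
Proof.
move=> e0; rewrite laplace_dual mulmxDr mulmxDl mxE ltr_wpDr//.
  have := metric_ge0 z (G z *m adjmx (a z) *m e).
  rewrite !adjmxM adjmxK dual_adj !mulmxA.
  by rewrite (mulmxKV (metric_unit z)).
(* One tangent vector suffices: the base has complex dimension one, so c = 1 is taken. *)
have := @Kpos z 1 (G z *m e) (oner_neq0 _) (dual_neq0 z e0).
rewrite conjc1 !mul1r adjmxM dual_adj !mulmxA.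
by rewrite (mulmxKV (metric_unit z)).
Qed.

End HermitianMetrics.

(** * Maximum principle on the sphere *)

Section MaximumPrinciple.
Context {R : realType}.
Notation C := R[i].

Lemma Im_deriv_c (f : C -> C) v z :
  (forall w, complex.Im (f w) = 0) -> complex.Im (deriv_c f v z) = 0.
Proof.
move=> f0; rewrite /= /real_deriv (_ : _ \o _ = cst 0) ?derive_cst//.
by apply/funext => w /=.
Qed.

(** Here r and s stand for the pure second derivatives and p, q for the mixed ones; as p and q are
    real, they contribute only to the imaginary part. *)
Lemma Re_quarter (p q r s : C) : complex.Im p = 0 -> complex.Im q = 0 ->
  complex.Re (((r - iunit * p) / 2 + iunit * ((q - iunit * s) / 2)) / 2) =
  (complex.Re r + complex.Re s) / 4.
Proof.
move=> p0 q0; have half (x : C) : complex.Re (x / 2) = complex.Re x / 2.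
  by rewrite {2}(splitr x) ReD -mulr2n -(mulr_natr (complex.Re _)) mulfK// pnatr_eq0.
rewrite (mulrA iunit) -mulrDl !half.
case: p q r s p0 q0 => [p1 p2] [q1 q2] [r1 r2] [s1 s2] /= -> ->.
by field.
Qed.

(** This is the identity between d_zbar d_z and a quarter of the Laplacian. *)
Lemma Re_dzbar_dz (f : C -> C) z : csmooth f -> (forall w, complex.Im (f w) = 0) ->
  complex.Re (dzbar (dz f) z) =
    (complex.Re (deriv_c (deriv_c f 1) 1 z) +
     complex.Re (deriv_c (deriv_c f iunit) iunit z)) / 4.
Proof.
move=> sf f0; have sd v := @csmooth_deriv_c _ _ v sf.
have sN : csmooth (fun w => - iunit * deriv_c f iunit w).
  by apply: csmoothM; [exact: csmooth_cst|exact: sd].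
have E v w : deriv_c (dz f) v w =
    (deriv_c (deriv_c f 1) v w - iunit * deriv_c (deriv_c f iunit) v w) / 2.
  have -> : dz f = (fun w => (deriv_c f 1 w + (- iunit) * deriv_c f iunit w) / 2).
    by apply/funext => t; rewrite mulNr.
  rewrite deriv_cM; [|exact: csmoothD|exact: csmooth_cst].
  rewrite deriv_c_cst mulr0 addr0 deriv_cD// deriv_cM//; last exact: csmooth_cst.
  by rewrite deriv_c_cst mul0r add0r mulNr.
have Im0 v w := Im_deriv_c w z (fun t => Im_deriv_c v t f0).
by rewrite /dzbar !E Re_quarter// Im0.
Qed.

Lemma Re_deriv_c2 (f : C -> C) v z : complex.Re (deriv_c (deriv_c f v) v z) =
  'D_(pl v) (fun p => 'D_(pl v) ((fun w => complex.Re (f w)) \o cx) p) (pl z).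
Proof.
rewrite /= /real_deriv; congr (derive _ _ _).
Qed.

(** At a maximum both pure second derivatives are nonpositive, hence so is the Laplacian. *)
Lemma subharmonic_no_max (f : C -> C) z :
  csmooth f -> (forall w, complex.Im (f w) = 0) -> 0 < dzbar (dz f) z ->
  ~ forall w, complex.Re (f w) <= complex.Re (f z).
Proof.
move=> sf f0 + fmax; rewrite ltcE => /andP[_]; rewrite Re_dzbar_dz//.
have D v : complex.Re (deriv_c (deriv_c f v) v z) <= 0.
  rewrite Re_deriv_c2; apply: derive2_at_max; first exact: sf.1.
  by move=> q; rewrite /= plK.
apply/negP; rewrite -leNgt; apply: mulr_le0_ge0; last by rewrite invr_ge0.
by rewrite -[X in _ <= X]addr0; exact: (lerD (D 1) (D iunit)).
Qed.

(** Used in place of the closed unit disc, which it contains; it is compact as a product of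
    segments. *)
Definition unit_square : set (R * R) := `[-1, 1] `*` `[-1, 1].

Lemma square_max (f : C -> C) : csmooth f -> exists2 p, unit_square p &
  forall q, unit_square q -> complex.Re (f (cx q)) <= complex.Re (f (cx p)).
Proof.
move=> [sf _].
have cS : compact unit_square by apply: compact_setX; exact: segment_compact.
have S0 : unit_square !=set0.
  by exists (0, 0); split; rewrite /= in_itv/=; apply/andP; split; lra.
have [|p /set_mem pS pmax] := @compact_EVT_max _ _
  ((fun w => complex.Re (f w)) \o cx) _ S0 cS.
  by apply: continuous_subspaceT; exact: smooth_continuous.
by exists p => // q qS; apply: pmax; exact/mem_set.
Qed.

(** One of z and 1 / z has modulus at most 1, and the closed unit disc lies in the square. *)
Lemma unit_square_inv (z : C) : z != 0 -> unit_square (pl z) \/ unit_square (pl z^-1).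
Proof.
have S (w : C) : complex.Re w ^+ 2 + complex.Im w ^+ 2 <= 1 -> unit_square (pl w).
  case: w => a b /= ab1; split; rewrite /= in_itv/=.
    by apply/andP; split; nra.
  by apply/andP; split; nra.
case: z => a b z0.
have n0 : 0 < a ^+ 2 + b ^+ 2.
  rewrite lt_neqAle addr_ge0 ?sqr_ge0// andbT eq_sym paddr_eq0 ?sqr_ge0//.
  by rewrite !sqrf_eq0; move: z0; rewrite eq_complex.
have [le1|gt1] := lerP (a ^+ 2 + b ^+ 2) 1; first by left; exact: S.
right; apply: S => /=.
rewrite [leLHS](_ : _ = (a ^+ 2 + b ^+ 2)^-1); first by rewrite invf_le1// ltW.
by field; rewrite gt_eqF.
Qed.

(* The unit squares of the two charts cover the sphere. *)
Lemma sphere_max (f0 f1 : C -> C) : csmooth f0 -> csmooth f1 ->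
  (forall w, w != 0 -> f0 w^-1 = f1 w) ->
  exists M, (forall w, complex.Re (f0 w) <= M /\ complex.Re (f1 w) <= M) /\
    exists z, complex.Re (f0 z) = M \/ complex.Re (f1 z) = M.
Proof.
move=> s0 s1 f01; have [p0 p0S p0max] := square_max s0.
have [p1 p1S p1max] := square_max s1.
pose M := Num.max (complex.Re (f0 (cx p0))) (complex.Re (f1 (cx p1))).
have M0 w : unit_square (pl w) -> complex.Re (f0 w) <= M.
  by move=> /p0max; rewrite plK le_max => ->.
have M1 w : unit_square (pl w) -> complex.Re (f1 w) <= M.
  by move=> /p1max; rewrite plK le_max => ->; rewrite orbT.
have S0 : unit_square (pl 0).
  by split; rewrite /= in_itv/=; apply/andP; split; lra.
exists M; split=> [w|].
  have [->|w0] := eqVneq w 0; first by split; [exact: M0|exact: M1].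
  have w'0 : w^-1 != 0 by rewrite invr_eq0.
  split; have [wS|wS] := unit_square_inv w0.
  - exact: M0.
  - by rewrite -[w]invrK f01//; exact: M1.
  - exact: M1.
  - by rewrite -f01//; exact: M0.
rewrite /M; case: leP => _; [exists (cx p1); by right|exists (cx p0); by left].
Qed.

End MaximumPrinciple.

(** * Diagonal matrices as Hermitian forms *)

Section DiagonalForms.
Context {R : realType} {m : nat}.
Notation C := R[i].

Lemma adjmx_delta (j : 'I_m) : adjmx (delta_mx j 0 : 'cV[C]_m) = delta_mx 0 j.
Proof. by rewrite /adjmx map_delta_mx trmx_delta. Qed.

Lemma delta_form (A : 'M[C]_m) j :
  (adjmx (delta_mx j 0 : 'cV[C]_m) *m A *m (delta_mx j 0 : 'cV[C]_m)) 0 0 = A j j.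
Proof. by rewrite adjmx_delta -rowE -colE !mxE. Qed.

Lemma delta_neq0 (j : 'I_m) : delta_mx j 0 != 0 :> 'cV[C]_m.
Proof. by apply/eqP => /matrixP/(_ j 0)/eqP; rewrite !mxE !eqxx oner_eq0. Qed.

(** The form is the sum of d_i |xi_i|^2, with a positive term wherever xi is nonzero. *)
Lemma diag_form_gt0 (d : 'rV[C]_m) (xi : 'cV[C]_m) :
  (forall j, 0 < d 0 j) -> xi != 0 -> 0 < (adjmx xi *m diag_mx d *m xi) 0 0.
Proof.
move=> d0 /cV0Pn[j xij].
have E : (adjmx xi *m diag_mx d *m xi) 0 0 = \sum_i d 0 i * (xi i 0 * conjc (xi i 0)).
  rewrite mul_mx_diag mxE; apply: eq_bigr => i _; rewrite !mxE.
  by rewrite [conjc _ * _]mulrC -mulrA [conjc _ * _]mulrC.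
have J (x : C) : x != 0 -> 0 < x * conjc x.
  by move=> x0; rewrite -sqr_normc exprn_gt0// normr_gt0.
rewrite E (bigD1 j)//=; apply: ltr_wpDr; last by apply: mulr_gt0 => //; exact: J.
by apply: sumr_ge0 => i _; rewrite mulr_ge0 ?mulcJ_ge0// ltW.
Qed.

Lemma adjmx_diag (d : 'rV[C]_m) : adjmx (diag_mx d) = diag_mx (map_mx (@conjc R) d).
Proof. by rewrite /adjmx map_diag_mx tr_diag_mx. Qed.

Lemma der_mx_diag (D : (C -> C) -> C -> C) (d : C -> 'rV[C]_m) z :
  derivation D ->
  der_mx D (fun w => diag_mx (d w)) z = diag_mx (\row_j D (fun w => d w 0 j) z).
Proof.
move=> [D0 _ _ _]; apply/matrixP => i j; rewrite !mxE.
have [->|ij] := eqVneq i j.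
  by rewrite mulr1n; congr (D _ z); apply/funext => w; rewrite !mxE eqxx.
rewrite mulr0n -[RHS](D0 0 z); congr (D _ z).
by apply/funext => w; rewrite !mxE (negbTE ij).
Qed.

End DiagonalForms.

(** * Griffiths positivity forces positive indices *)

Section Necessity.
Context {R : realType} {m : nat}.
Notation C := R[i].

Lemma Lambda_unit (kappa : 'I_m -> int) (z : C) : z != 0 -> Lambda kappa z \in unitmx.
Proof.
move=> z0; have : Lambda kappa z *m Lambda (fun j => - kappa j) z = 1%:M.
  rewrite /Lambda mulmx_diag -diag_const_mx; congr diag_mx.
  by apply/rowP => j; rewrite !mxE -expfzDr // subrr expr0z.
by case/mulmx1_unit.
Qed.

(** The diagonal entry is the form of H^-1 at the j-th basis vector, so [laplace_dual_gt0] makes it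
    strictly subharmonic. *)
Lemma griffiths_dual_no_max (H : C -> 'M[C]_m) j z :
  hermitian_metric H -> griffiths_positive_metric H ->
  ~ forall w, complex.Re (invmx (H w) j j) <= complex.Re (invmx (H z) j j).
Proof.
move=> hH [a [b [ch Kpos]]].
apply: (@subharmonic_no_max _ (fun w => invmx (H w) j j)).
- exact: dual_smooth.
- move=> w; have := dual_gt0 hH w (delta_neq0 j); rewrite delta_form.
  by rewrite ltcE => /andP[/eqP].
- have := laplace_dual_gt0 hH ch Kpos z (delta_neq0 j); rewrite delta_form mxE.
  suff -> : (fun w => dz_mx (fun z => invmx (H z)) w j j) = dz (fun w => invmx (H w) j j) by [].
  by apply/funext => w; rewrite mxE.
Qed.

Lemma griffiths_positive_ge1 (kappa : 'I_m -> int) j :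
  griffiths_positive (Lambda (R := R) kappa) -> 1 <= kappa j.
Proof.
move=> [H0 [H1 [h0 h1 glue p0 p1]]]; rewrite leNgt; apply/negP => kj.
have [k kE] : exists k : nat, kappa j = - k%:Z.
  by exists `|kappa j|%N; rewrite lez0_abs ?opprK// -ltzD1.
(* The squared norm of the holomorphic section of the dual bundle given by the
   j-th coordinate in the chart z, hence by w^k times it in the chart w = 1 / z. *)
pose f0 z := invmx (H0 z) j j.
pose f1 z := (z * conjc z) ^+ k * invmx (H1 z) j j.
have s0 : csmooth f0 by exact: dual_smooth.
have s1 : csmooth f1.
  apply: csmoothM; last exact: dual_smooth.
  apply: csmoothX; apply: csmoothM; first exact: csmooth_id.
  by apply: csmooth_conj; exact: csmooth_id.
have f01 w : w != 0 -> f0 w^-1 = f1 w.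
  move=> w0; have w'0 : w^-1 != 0 by rewrite invr_eq0.
  have gu := Lambda_unit kappa w'0; set g := Lambda kappa w^-1 in gu.
  (* Inverting the gluing relation at 1 / w gives the transition rule of the dual metric. Its j-th
     diagonal entry carries the factor |w^(- kappa_j)|^2 = |w|^(2k). *)
  have : invmx (H0 w^-1) = g *m invmx (H1 w) *m adjmx g.
    have : g *m invmx (H1 w) *m adjmx g *m H0 w^-1 *m g = g.
      rewrite -!mulmxA (mulmxA (adjmx g)) -glue// invrK mulVmx ?mulmx1//.
      exact: metric_unit.
    move=> /(congr1 (fun A => A *m invmx g)); rewrite mulmxK// mulmxV// => E.
    by rewrite -[RHS](mulmxK (metric_unit h0 w^-1)) E mul1mx.
  rewrite /f0 => ->; rewrite /g adjmx_diag mul_mx_diag mul_diag_mx !mxE kE.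
  rewrite /f1 mulrAC; congr (_ * _).
  by rewrite -exprnN -exprVn invrK rmorphXn/= exprMn.
have pos0 z : 0 < complex.Re (f0 z).
  have := dual_gt0 h0 z (delta_neq0 j); rewrite delta_form.
  by rewrite ltcE => /andP[].
have [M [Mmax [z zM]]] := sphere_max s0 s1 f01.
(* The maximum is not attained in the chart z, by strict subharmonicity of [f0]. *)
have no0 w : complex.Re (f0 w) <> M.
  move=> wM; apply: (griffiths_dual_no_max (j := j) (z := w) h0 p0) => v.
  by rewrite -/(f0 w) wM; case: (Mmax v).
case: zM => zM; first exact: (no0 z).
(* A maximum point of [f1] other than w = 0 also lies in the chart z, which leaves w = 0. *)
have [z0|z0] := eqVneq z 0; last by apply: (no0 z^-1); rewrite f01.
(* If k = 0, the section does not vanish at w = 0 and [f1] is itself a diagonal entry of the dual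
   metric. If k > 0, it vanishes there, so the maximum would be 0, against the positivity of
   [f0]. *)
case: k {kE} @f1 s1 f01 Mmax zM => [|k] f1 s1 f01 Mmax zM.
  apply: (griffiths_dual_no_max (j := j) (z := z) h1 p1) => v.
  by move: zM (Mmax v) => <- [_]; rewrite /f1 !expr0 !mul1r.
have := Mmax 0; rewrite -zM z0 /f1 mul0r expr0n mul0r => -[+ _].
by rewrite leNgt pos0.
Qed.

End Necessity.

(** * Fubini-Study metrics on sums of line bundles *)

Section FubiniStudy.
Context {R : realType}.
Notation C := R[i].
Implicit Types z w : C.

(** The Fubini-Study metric of O(1), in either chart. *)
Definition fs_weight (z : C) : C := (1 + z * conjc z)^-1.

Lemma fs_gt0 z : 0 < 1 + z * conjc z.
Proof. by rewrite ltr_wpDr// mulcJ_ge0. Qed.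

Lemma fs_neq0 z : 1 + z * conjc z != 0.
Proof. by rewrite gt_eqF// fs_gt0. Qed.

Lemma csmooth_conjc : csmooth (fun z => conjc z).
Proof. by apply: csmooth_conj; exact: csmooth_id. Qed.

Lemma csmooth_normsq : csmooth (fun z : C => z * conjc z).
Proof. by apply: csmoothM; [exact: csmooth_id|exact: csmooth_conjc]. Qed.

Lemma csmooth_fs_inv : csmooth (fun z : C => 1 + z * conjc z).
Proof. by apply: csmoothD; [exact: csmooth_cst|exact: csmooth_normsq]. Qed.

Lemma csmooth_fs : csmooth fs_weight.
Proof. by apply: csmoothV; [exact: fs_neq0|exact: csmooth_fs_inv]. Qed.

(** Differentiate the constant product f f^-1. *)
Lemma derivationV D (f : C -> C) z : derivation D -> (forall w, f w != 0) -> csmooth f ->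
  D (fun w => (f w)^-1) z = - (D f z * (f z)^-1 ^+ 2).
Proof.
move=> [D0 _ _ DM] f0 sf; have := D0 1 z.
have -> : (fun=> 1) = (fun w => f w * (f w)^-1) by apply/funext => w; rewrite mulfV.
rewrite DM//; last exact: csmoothV.
move=> /eqP; rewrite addrC addr_eq0 => /eqP h.
by rewrite -[LHS](mulKf (f0 z)) h mulrN expr2 mulrCA.
Qed.

Lemma dz_fs z : dz fs_weight z = - (conjc z * fs_weight z ^+ 2).
Proof.
have [D0 _ DD DM] := @derivation_dz R.
rewrite derivationV; [|exact: derivation_dz|exact: fs_neq0|exact: csmooth_fs_inv].
rewrite DD; [|exact: csmooth_cst|exact: csmooth_normsq].
rewrite D0 add0r DM; [|exact: csmooth_id|exact: csmooth_conjc].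
by rewrite dz_id mul1r dz_conj ?dzbar_id ?conjc0 ?mulr0 ?addr0//; exact: csmooth_id.
Qed.

Lemma dzbar_fs z : dzbar fs_weight z = - (z * fs_weight z ^+ 2).
Proof.
have [D0 _ DD DM] := @derivation_dzbar R.
rewrite derivationV; [|exact: derivation_dzbar|exact: fs_neq0|exact: csmooth_fs_inv].
rewrite DD; [|exact: csmooth_cst|exact: csmooth_normsq].
rewrite D0 add0r DM; [|exact: csmooth_id|exact: csmooth_conjc].
by rewrite dzbar_id mul0r add0r dzbar_conj ?dz_id ?conjc1 ?mulr1//; exact: csmooth_id.
Qed.

(** The right-hand side is factored as H times a, so that its second factor is the Chern connection
    coefficient of O(n). *)
Lemma dz_fsX n z :
  dz (fun w => fs_weight w ^+ n) z = fs_weight z ^+ n * (- n%:R * (conjc z * fs_weight z)).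
Proof.
have [D0 _ _ DM] := @derivation_dz R.
elim: n => [|n IH]; first by rewrite oppr0 mul0r mulr0; exact: D0.
have -> : (fun w => fs_weight w ^+ n.+1) = (fun w => fs_weight w * fs_weight w ^+ n).
  by apply/funext => w; rewrite exprS.
rewrite DM; [|exact: csmooth_fs|exact/csmoothX/csmooth_fs].
rewrite IH dz_fs (exprS _ n) -natr1.
by move: (fs_weight z) (fs_weight z ^+ n) (conjc z) (n%:R : C) => p q r s; ring.
Qed.

(** For c = - n this yields the curvature n / (1 + |z|^2)^2 of O(n), up to sign. *)
Lemma dzbar_fs_connection (c : C) z :
  dzbar (fun w => c * (conjc w * fs_weight w)) z = c * fs_weight z ^+ 2.
Proof.
have [D0 _ DD DM] := @derivation_dzbar R.
rewrite DM; [|exact: csmooth_cst|by apply: csmoothM; [exact: csmooth_conjc|exact: csmooth_fs]].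
rewrite D0 mul0r add0r DM; [|exact: csmooth_conjc|exact: csmooth_fs].
rewrite dzbar_fs dzbar_conj; last exact: csmooth_id.
rewrite dz_id conjc1 mul1r; congr (_ * _).
(* With p the weight, this relation turns p - |z|^2 p^2 into p^2. *)
have : (1 + z * conjc z) * fs_weight z = 1 by rewrite mulfV// fs_neq0.
move: (fs_weight z) (conjc z) => p q h.
have -> : p + q * - (z * p ^+ 2) = p * (1 + p - (1 + z * q) * p) by ring.
by rewrite h addrAC subrr add0r expr2.
Qed.

(** The gluing rule of a metric on O(1): passing to 1 / z multiplies the weight by |z|^2. *)
Lemma fs_weight_inv z : z != 0 -> fs_weight z^-1 = conjc z * fs_weight z * z.
Proof.
move=> z0; have zc0 : conjc z != 0 by rewrite conjc_eq0.
have := fs_neq0 z; rewrite /fs_weight conjc_inv => n0.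
have -> : 1 + z^-1 * (conjc z)^-1 = (1 + z * conjc z) / (z * conjc z).
  by rewrite mulrDl mul1r mulfV ?mulf_neq0// -invfM addrC.
by rewrite invf_div mulrC [RHS]mulrC mulrA [_^-1 * _]mulrC -mulrA [_^-1 * _]mulrC mulrA.
Qed.

Lemma conjc_fs z : conjc (fs_weight z) = fs_weight z.
Proof. by rewrite conjc_inv conjcD conjcM conjcK conjc1 [conjc z * _]mulrC. Qed.

Context {m : nat}.
Variable k : 'I_m -> nat.

Definition fs_metric (z : C) : 'M[C]_m := diag_mx (\row_j fs_weight z ^+ k j).

Lemma hermitian_fs_metric : hermitian_metric fs_metric.
Proof.
split=> [i j|z].
  suff : csmooth (fun z => fs_metric z i j) by [].
  have [->|ij] := eqVneq i j.
    have -> : (fun z => fs_metric z j j) = (fun z => fs_weight z ^+ k j).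
      by apply/funext => z; rewrite !mxE eqxx.
    exact/csmoothX/csmooth_fs.
  have -> : (fun z => fs_metric z i j) = (fun=> 0).
    by apply/funext => z; rewrite !mxE (negbTE ij).
  exact: csmooth_cst.
split=> [|xi xi0].
  rewrite adjmx_diag; congr diag_mx; apply/rowP => j.
  by rewrite !mxE rmorphXn/= conjc_fs.
by apply: diag_form_gt0 => // j; rewrite mxE exprn_gt0// invr_gt0 fs_gt0.
Qed.

(** The curvature is diagonal with entries k_j / (1 + |z|^2)^2, positive exactly because every k_j
    is. *)
Lemma griffiths_fs_metric : (forall j, (0 < k j)%N) -> griffiths_positive_metric fs_metric.
Proof.
move=> k0.
pose a (z : C) : 'M[C]_m := diag_mx (\row_j (- (k j)%:R * (conjc z * fs_weight z))).
have ch : chern_connection fs_metric a (fun=> 0).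
  split=> // z; rewrite /adjmx map_mx0 trmx0 mul0mx addr0.
  rewrite [LHS](der_mx_diag _ _ derivation_dz) mulmx_diag; congr diag_mx.
  apply/rowP => j; rewrite !mxE -dz_fsX; congr (dz _ z).
  by apply/funext => w; rewrite mxE.
exists a, (fun=> 0); split=> // z c xi c0 xi0.
rewrite (chern_curvature ch) [dzbar_mx _ _](der_mx_diag _ _ derivation_dzbar).
apply: mulr_gt0; first by rewrite -sqr_normc exprn_gt0// normr_gt0.
have p0 : 0 < fs_weight z by rewrite invr_gt0 fs_gt0.
set b := (X in - X).
(* The term [b] is d_zbar of the connection form, whose opposite is the curvature. *)
have -> : b = - diag_mx (\row_j ((k j)%:R * fs_weight z ^+ 2)).
  rewrite -raddfN; congr diag_mx; apply/rowP => j; rewrite !mxE -mulNr.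
  rewrite -dzbar_fs_connection; congr (dzbar _ z).
  by apply/funext => w; rewrite mxE.
rewrite opprK.
rewrite mulmxA -(mulmxA (adjmx xi)) mulmx_diag.
apply: diag_form_gt0 => // j; rewrite !mxE.
by rewrite !mulr_gt0 ?exprn_gt0// ltr0n.
Qed.

(** On each summand this is the k_j-th power of the rule for O(1). *)
Lemma fs_glue z : z != 0 -> fs_metric z^-1 =
  adjmx (Lambda (fun j => (k j)%:Z) z) *m fs_metric z *m Lambda (fun j => (k j)%:Z) z.
Proof.
move=> z0; rewrite adjmx_diag !mulmx_diag; congr diag_mx; apply/rowP => j.
by rewrite !mxE fs_weight_inv// !exprMn -exprnP rmorphXn.
Qed.

End FubiniStudy.

(** * Positive indices give a Griffiths positive metric *)

Lemma griffiths_positive_Lambda (R : realType) m (kappa : 'I_m -> int) :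
  (forall j, 1 <= kappa j) -> griffiths_positive (Lambda (R := R) kappa).
Proof.
move=> k1; pose k j := `|kappa j|%N.
have kE j : kappa j = (k j)%:Z by rewrite gez0_abs// (le_trans _ (k1 j)).
have k0 j : (0 < k j)%N by rewrite absz_gt0 gt_eqF// (lt_le_trans _ (k1 j)).
have -> : kappa = (fun j => (k j)%:Z) by apply/funext.
(* The Fubini-Study metrics have the same expression in both charts, so one matrix function serves
   twice. *)
exists (fs_metric k), (fs_metric k); split.
- exact: hermitian_fs_metric.
- exact: hermitian_fs_metric.
- by move=> z; exact: fs_glue.
- exact: griffiths_fs_metric.
- exact: griffiths_fs_metric.
Qed.

Unset Implicit Arguments.

Theorem theorem1p3 (R : realType) (m : nat) (X : topologicalType)
    (M : complex_manifold (R := R) m X) (K : kahler_form M)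
    (nabla : chart_idx M -> 'rV[R]_m * 'rV[R]_m -> 'rV[R]_m * 'rV[R]_m ->
             'rV[R]_m * 'rV[R]_m -> 'rV[R]_m * 'rV[R]_m)
    (n : nat) (L : nat -> set X) (x : nat -> X) (y : X) (u : R[i] -> X)
    (alpha : R) (kappa : 'I_m -> int) :
  levi_civita K nabla ->
  (0 < n)%N ->
  (forall k, (1 <= k <= n)%N -> lagrangian K (L k)) ->
  (forall k l, (1 <= k <= n)%N -> (1 <= l <= n)%N -> k != l ->
     transverse M (L k) (L l)) ->
  (forall k, (1 <= k < n)%N -> L k (x k) /\ L k.+1 (x k)) ->
  L 1%N y -> L n y ->
  disc_connecting M n L x y u ->
  0 < alpha < 1 ->
  disc_partial_maslov_indices nabla n L u alpha kappa ->
  ((forall j : 'I_m, 1 <= kappa j) <->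
   griffiths_positive (doubled_bundle (R := R) kappa)).
Proof.
move=> _ _ _ _ _ _ _ _ _ _; split; first exact: griffiths_positive_Lambda.
by move=> gp j; exact: (griffiths_positive_ge1 (kappa := kappa) j gp).
Qed.
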